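(* Let $c\ge1$ and $N\ge 2$ be integers, and let $\mathcal{P}$ be a finite bias distribution with possible outputs $p_0<p_1<\dots<p_k$. Let $\delta\ge 0$ and let $U_0,\dots,U_k$ be reals with $|U_i-\sigma(p_i)|\le\delta$ for all $i$. Let $\mathcal{R}>0$ satisfy $\mathcal{R}\le\min_{1\le\ell\le c}\mathcal{R}_{\ell,\mathcal{P}}$; let $\psi_1,\psi_2>0$ satisfy $\psi_1\le\sigma(p_0)\le\psi_2$; let $\eta_1,\eta_2>0$; let $x_1,x_2>0$ satisfy $x_i\,r(x_i)\le\eta_i\mathcal{R}\psi_1/c$ for $i=1,2$; and let $\varepsilon_1,\varepsilon_2\in(0,1)$. Assume $D:=(1-\eta_1-\eta_2/c)\mathcal{R}-2\delta c>0$, and choose $A_1,A_2$ with $$A_i\ge\frac{c}{D}\cdot\frac{\psi_2}{x_i}\log\frac{1}{\varepsilon_i}\quad(i=1,2)$$ such that $m:=A_1+A_2$ is a positive integer. Put $$Z=\Bigl(\bigl(1-\tfrac{\eta_2}{c}\bigr)\tfrac{\mathcal{R}}{c}-\delta\Bigr)A_1+\Bigl(\tfrac{\eta_1\mathcal{R}}{c}+\delta\Bigr)A_2.$$ Consider the fingerprinting scheme with $N$ users, code length $m$, bias distribution $\mathcal{P}$, approximated scores $U_0,\dots,U_k$ and threshold $Z$ (described in the context). Then for any number $\ell$ of pirates with $1\le\ell\le c$ and any pirates' strategy, the probability of false-positive is less than $1-(1-\varepsilon_1)^{N-1}$ $(\le(N-1)\varepsilon_1)$ and the probability of false-negative is less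 than $\varepsilon_2$. Consequently the total tracing error probability is at most $(N-1)\varepsilon_1+\varepsilon_2$, which equals $\varepsilon$ when $\varepsilon_1=\varepsilon_2=\varepsilon/N$.
   Context: A finite bias distribution is a probability distribution $\mathcal{P}$ supported on a finite subset of $(0,1)$ that is symmetric (outputs $a$ and $1-a$ with the same probability). $E_p$ is expectation over $p\sim\mathcal{P}$. $\sigma(p)=\sqrt{(1-p)/p}$; $f_{\ell,x}(p)=p^x(1-p)^{\ell-x}(x\sigma(p)-(\ell-x)\sigma(1-p))$; $R_{\ell,x}=\max\{0,E_p[f_{\ell,x}(p)]\}$; $\mathcal{R}_{\ell,\mathcal{P}}=E_p[-f_{\ell,0}(p)]-\sum_{x=1}^{\ell-1}\binom{\ell}{x}R_{\ell,x}$; $r(t)=(e^t-1-t)/t^2$ for $t>0$; $\log$ is the natural logarithm. Scheme: the server draws $p^{(1)},\dots,p^{(m)}$ independently from $\mathcal{P}$ (kept secret), and for each user $u_i$ ($1\le i\le N$) a codeword $w_i\in\{0,1\}^m$ whose bits $w_{i,j}$ are all independent with $\Pr(w_{i,j}=1)=p^{(j)}$. A set of $\ell$ pirates produces a pirated word $y\in\{0,1,?\}^m$ by an arbitrary (possibly randomized) strategy that uses only the pirates' own codewords (and the public description of $\mathcal{P}$), so that $y$ is independent of the innocent users' codewords and, given the pirates' codewords, of the actual values $p^{(j)}$; it must satisfy the Marking Assumption: if all pirates' bits at position $j$ coincide, then $y_j$ equals that common bit. Approximated tracing: let $\nu_j$ be the index with $p^{(j)}=p_{\nu_j}$; user $u_i$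 gets score $\widehat S_i=\sum_{j=1}^m\widehat S_i^{(j)}$ where $\widehat S_i^{(j)}=U_{\nu_j}$ if $(y_j,w_{i,j})=(1,1)$, $-U_{k-\nu_j}$ if $(y_j,w_{i,j})=(1,0)$, and $0$ if $y_j\in\{0,?\}$; the algorithm outputs all users with $\widehat S_i\ge Z$. False-positive: at least one innocent (non-pirate) user is output. False-negative: no pirate is output. Tracing error: false-positive or false-negative. *)

(* Defs.v *)
From HB Require Import structures.
From mathcomp Require Import all_boot all_order all_algebra.
From mathcomp Require Import reals.
From mathcomp.analysis Require Import sequences exp.
Set Implicit Arguments. Unset Strict Implicit. Unset Printing Implicit Defensive.
Import Order.TTheory GRing.Theory Num.Theory.
Local Open Scope ring_scope.

Section Defs.
Variable R : realType.

Definition sigma (p : R) : R := Num.sqrt ((1 - p) / p).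

Definition fpoly (l x : nat) (p : R) : R :=
  p ^+ x * (1 - p) ^+ (l - x) * (x%:R * sigma p - (l - x)%:R * sigma (1 - p)).

Definition rfun (t : R) : R := (expR t - 1 - t) / t ^+ 2.

Definition finite_bias_dist (k : nat) (p q : 'I_k.+1 -> R) : Prop :=
  [/\ (forall i, 0 < p i < 1),
      (forall i j : 'I_k.+1, (i < j)%N -> p i < p j),
      (forall i, 0 < q i),
      \sum_i q i = 1 &
      (forall i, p (rev_ord i) = 1 - p i /\ q (rev_ord i) = q i)].

Definition Ebias (k : nat) (p q : 'I_k.+1 -> R) (g : R -> R) : R :=
  \sum_i q i * g (p i).

Definition Rlx (k : nat) (p q : 'I_k.+1 -> R) (l x : nat) : R :=
  Num.max 0 (Ebias p q (fpoly l x)).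

Definition calR (k : nat) (p q : 'I_k.+1 -> R) (l : nat) : R :=
  Ebias p q (fun t => - fpoly l 0 t)
  - \sum_(1 <= x < l) 'C(l, x)%:R * Rlx p q l x.

(* Secret biases: nu j is the index with p^(j) = p_(nu j).
   Codewords: w i j is the bit of user i at position j.
   Pirated word: y j = Some b for the bit b, None for '?'. *)
Definition biasvec (k m : nat) := {ffun 'I_m -> 'I_k.+1}.
Definition codes (N m : nat) := {ffun 'I_N -> {ffun 'I_m -> bool}}.
Definition pword (m : nat) := {ffun 'I_m -> option bool}.

(* A (randomized) pirate strategy for the pirate set S: for each code matrix,
   a probability distribution over pirated words, which depends only on the
   pirates' codewords and satisfies the Marking Assumption. *)
Definition pirate_strategy (N m : nat) (S : {set 'I_N})
    (rho : codes N m -> pword m -> R) : Prop :=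
  [/\ (forall w y, 0 <= rho w y),
      (forall w, \sum_y rho w y = 1),
      (forall w w' : codes N m, (forall i, i \in S -> w i = w' i) -> rho w = rho w') &
      (forall w y, 0 < rho w y -> forall (j : 'I_m) (b : bool),
          (forall i, i \in S -> w i j = b) -> y j = Some b)].

Definition score (k m N : nat) (U : 'I_k.+1 -> R) (nu : biasvec k m)
    (w : codes N m) (y : pword m) (i : 'I_N) : R :=
  \sum_(j < m) (if y j == Some true then
                  (if w i j then U (nu j) else - U (rev_ord (nu j)))
                else 0).

Definition scheme_prob (k m N : nat) (p q : 'I_k.+1 -> R)
    (rho : codes N m -> pword m -> R)
    (E : biasvec k m -> codes N m -> pword m -> bool) : R :=
  \sum_(nu : biasvec k m) \sum_(w : codes N m) \sum_(y : pword m)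
    ((\prod_(j < m) q (nu j)) *
     (\prod_(i < N) \prod_(j < m) (if w i j then p (nu j) else 1 - p (nu j))) *
     rho w y * (E nu w y)%:R).

Definition false_pos (k m N : nat) (U : 'I_k.+1 -> R) (Z : R) (S : {set 'I_N})
    (nu : biasvec k m) (w : codes N m) (y : pword m) : bool :=
  [exists i, (i \notin S) && (Z <= score U nu w y i)].

Definition false_neg (k m N : nat) (U : 'I_k.+1 -> R) (Z : R) (S : {set 'I_N})
    (nu : biasvec k m) (w : codes N m) (y : pword m) : bool :=
  [forall i, (i \in S) ==> (score U nu w y i < Z)].

End Defs.

(* Main.v *)
(** Both error bounds are Chernoff bounds based on
    [expR s <= 1 + s + rfun x * s ^+ 2] for [`|s| <= x].

    Innocent users: given the biases and the pirated word, the exact score of an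
    innocent user at one position has mean 0 and variance at most 1, so with
    [alpha = x1 / psi2] the moment generating function of the approximated score
    is at most [(expR (alpha * delta) * (1 + rfun x1 * alpha ^+ 2)) ^+ m].
    Innocent scores are independent, whence the power [N - 1].

    Pirates: if no pirate is accused, the sum of the [l] pirate scores is below
    [l * Z].  Conditioning on the pirates' codewords, the secret biases at the
    positions are independent, and the exponential moment of the sum factors over
    the columns.  In each column the pirates can at best pick the worst answer
    allowed by the Marking Assumption; summed over all columns, the first-order
    terms of this worst case give exactly [- calR p q l] by the symmetry
    [p <-> 1 - p], and the second-order terms give the variance [l]. *)

Require Import Defs.
From HB Require Import structures.
From mathcomp Require Import all_boot all_order all_algebra.
From mathcomp Require Import reals topology normedtype.
From mathcomp.analysis Require Import sequences exp.
From mathcomp Require Import ring lra.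
Import Order.TTheory GRing.Theory Num.Theory.
Local Open Scope ring_scope.

(** * The quadratic bound on the exponential and elementary properties of [sigma] *)

Section Analysis.
Context {R : realType}.
Implicit Types p s x : R.

(** The exponential series is compared term by term: from degree 2 on, [s ^+ n] is at most
    [(s / x) ^+ 2 * x ^+ n], as [s] is at most [x] in absolute value. *)
Lemma expR_le_quadratic x s : 0 < x -> `|s| <= x ->
  expR s <= 1 + s + rfun x * s ^+ 2.
Proof.
move=> x0 sx; have xn0 : x != 0 by rewrite gt_eqF.
have coef_bound n : (2 <= n)%N ->
    exp_coeff s n <= s ^+ 2 / x ^+ 2 * exp_coeff x n.
  case: n => [|[|n]] // _; rewrite /exp_coeff /= mulrA.
  rewrite ler_pM2r ?invr_gt0 ?ltr0n ?fact_gt0 //.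
  rewrite -addn2 !exprD mulrC -[s ^+ 2 / _ * _]mulrA.
  have -> : (x ^+ 2)^-1 * (x ^+ n * x ^+ 2) = x ^+ n.
    by rewrite mulrCA mulVf ?mulr1 // expf_neq0.
  apply: ler_wpM2l; first exact: sqr_ge0.
  rewrite (le_trans (ler_norm _)) // normrX.
  by apply: lerXn2r => //; rewrite nnegrE ?normr_ge0 // ltW.
have partial_le n : series (exp_coeff x) n <= expR x.
  apply: nondecreasing_cvgn_le; last exact: is_cvg_series_exp_coeff.
  apply/nondecreasing_seqP => k; rewrite seriesSr lerDl.
  exact: exp_coeff_ge0 (ltW x0).
(* In the limit only long partial sums matter, so the terms [1] and [s] can be split off exactly. *)
apply: limr_le; first exact: is_cvg_series_exp_coeff.
exists 2%N => // n /= n2.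
have split2 y : series (exp_coeff y) n =
    1 + y + \sum_(2 <= i < n) exp_coeff y i.
  rewrite /series /= big_ltn ?(ltn_trans _ n2) // big_ltn ?(leq_trans _ n2) //.
  by rewrite /exp_coeff /= expr0 expr1 fact0 factS fact0 !divr1 addrA.
have := partial_le n; rewrite !split2 => hx.
have : \sum_(2 <= i < n) exp_coeff s i
    <= s ^+ 2 / x ^+ 2 * (\sum_(2 <= i < n) exp_coeff x i).
  rewrite big_distrr /=; rewrite !big_nat; apply: ler_sum => i /andP[i2 _].
  exact: coef_bound.
move=> h; rewrite lerD2l; apply: le_trans h _.
have -> : rfun x * s ^+ 2 = s ^+ 2 / x ^+ 2 * (expR x - 1 - x).
  by rewrite /rfun -mulrA mulrC [_^-1 * _]mulrC.
by apply: ler_wpM2l; [rewrite divr_ge0 ?sqr_ge0 | lra].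
Qed.

Lemma rfun_gt0 x : 0 < x -> 0 < rfun x.
Proof.
move=> x0; apply: divr_gt0; last by rewrite exprn_gt0.
by have := expR_gt1Dx (lt0r_neq0 x0); lra.
Qed.

Lemma sigma_ge0 p : 0 <= sigma p. Proof. exact: sqrtr_ge0. Qed.

Lemma mul_sigma_sqr p : 0 < p < 1 -> p * sigma p ^+ 2 = 1 - p.
Proof.
move=> /andP[p0 p1]; rewrite sqr_sqrtr; first by rewrite mulrCA divff ?mulr1 ?gt_eqF.
by apply: divr_ge0; lra.
Qed.

(** Both sides are nonnegative with square [p * (1 - p)]. This is what makes the exact score of an
    innocent bit have mean zero. *)
Lemma mul_sigmaC p : 0 < p < 1 -> p * sigma p = (1 - p) * sigma (1 - p).
Proof.
move=> p01; have p01' : 0 < 1 - p < 1 by lra.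
apply/eqP; rewrite -(@eqrXn2 _ 2) //; last 2 first.
- by rewrite mulr_ge0 ?sigma_ge0 //; lra.
- by rewrite mulr_ge0 ?sigma_ge0 //; lra.
have := mul_sigma_sqr p p01; have := mul_sigma_sqr _ p01'.
rewrite !exprMn !(expr2 p) !(expr2 (1 - p)) -!mulrA => -> ->.
by apply/eqP; ring.
Qed.

Lemma sigma_anti p p' : 0 < p -> p <= p' -> p' < 1 -> sigma p' <= sigma p.
Proof.
move=> p0 pp' p1; rewrite ler_sqrt; last by apply: divr_ge0; lra.
have p'0 : 0 < p' by lra.
rewrite ler_pdivrMr // mulrAC ler_pdivlMr //; nra.
Qed.

End Analysis.

(** * Sums over families of words: transposition, counting ones, splitting the users,
    independence *)

Section FiniteSums.
Context {R : realType}.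

(** Transposition turns a family of rows into a family of columns, over which the product
    distributes. *)
Lemma sum_prod_columns (I J A : finType) (H : {ffun I -> A} -> R) :
  \sum_(u : {ffun I -> {ffun J -> A}}) \prod_j H [ffun i => u i j]
  = (\sum_b H b) ^+ #|J|.
Proof.
rewrite -prodr_const bigA_distr_bigA /=.
pose tr (I J : finType) (u : {ffun I -> {ffun J -> A}}) :=
  [ffun j => [ffun i => u i j]].
have trK I' J' : cancel (@tr I' J') (@tr J' I').
  by move=> u; apply/ffunP => i; apply/ffunP => j; rewrite !ffunE.
rewrite (reindex (tr J I)); last by exists (tr I J) => u _; exact: trK.
apply: eq_bigr => u _; apply: eq_bigr => j _; congr H.
by apply/ffunP => i; rewrite !ffunE.
Qed.

Lemma sum_count (I : finType) (F : nat -> R) :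
  \sum_(b : {ffun I -> bool}) F (\sum_i b i)%N
  = \sum_(x < #|I|.+1) 'C(#|I|, x)%:R * F x.
Proof.
rewrite (reindex (fun A : {set I} => [ffun i => i \in A])); last first.
  exists (fun b : {ffun I -> bool} => [set i | b i]) => A _.
    by apply/setP => i; rewrite inE ffunE.
  by apply/ffunP => i; rewrite ffunE inE.
have cnt (A : {set I}) : (\sum_i [ffun i => i \in A] i)%N = #|A|.
  by rewrite -sum1_card [RHS]big_mkcond; apply: eq_bigr => i _; rewrite ffunE.
under eq_bigr do rewrite cnt.
(* [inord] loses nothing here, since a subset has at most [#|I|] elements. *)
rewrite /= (partition_big (fun A : {set I} => inord #|A| : 'I_#|I|.+1) xpredT) //=.
apply: eq_bigr => x _; rewrite -card_draws.
rewrite -(sum1_card (mem [set A : {set I} | #|A| == x])) natr_sum mulr_suml.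
apply: eq_big => [A|A /eqP <-].
  by rewrite inE -val_eqE /= inordK // ltnS max_card.
by rewrite inordK ?ltnS ?max_card // mul1r.
Qed.

Lemma prod_if_count (I : finType) (b : {ffun I -> bool}) (x y : R) :
  \prod_i (if b i then x else y)
  = x ^+ (\sum_i b i) * y ^+ (#|I| - \sum_i b i).
Proof.
rewrite (bigID b) /=.
rewrite [X in X * _](eq_bigr (fun=> x)) => [|i ->//].
rewrite [X in _ * X](eq_bigr (fun=> y)) => [|i /negbTE ->//].
rewrite !prodr_const.
have -> : (\sum_i b i)%N = #|[pred i | b i]|.
  by rewrite -sum1_card [RHS]big_mkcond.
by rewrite -(cardC [pred i | b i]) addKn.
Qed.

Lemma count_le (I : finType) (b : {ffun I -> bool}) : (\sum_i b i <= #|I|)%N.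
Proof. by rewrite -sum1_card; apply: leq_sum => i _; case: (b i). Qed.

(** The default [t0] is never reached: every index lies in [S] or in its complement. *)
Definition merge_ffun {I T : finType} {S : {set I}} (t0 : T)
    (u : {ffun {i in S} -> T}) (v : {ffun {i in ~: S} -> T}) : {ffun I -> T} :=
  [ffun i => oapp u (oapp v t0 (insub i)) (insub i)].

Section Merge.
Variables (I T : finType) (S : {set I}) (t0 : T).
Implicit Types (u : {ffun {i in S} -> T}) (v : {ffun {i in ~: S} -> T}).

Lemma merge_in u v (i : {i in S}) : merge_ffun t0 u v (val i) = u i.
Proof. by rewrite ffunE valK. Qed.

Lemma merge_notin u v (i : {i in ~: S}) : merge_ffun t0 u v (val i) = v i.
Proof.
by rewrite ffunE valK insubN //=; have := valP i; rewrite inE.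
Qed.

Lemma sum_merge (F : {ffun I -> T} -> R) :
  \sum_w F w = \sum_u \sum_v F (@merge_ffun I T S t0 u v).
Proof.
rewrite pair_big /=.
rewrite (reindex (fun uv => @merge_ffun I T S t0 uv.1 uv.2)) //=.
exists (fun w => ([ffun i : {i in S} => w (val i)],
                  [ffun i : {i in ~: S} => w (val i)])) => [[u v] _|w _].
  by congr pair; apply/ffunP => i; rewrite ffunE ?merge_in ?merge_notin.
apply/ffunP => i; have [iS|iS] := boolP (i \in S).
  by rewrite -[i]/(val (Sub i iS : {i in S})) merge_in ffunE.
have iS' : i \in ~: S by rewrite inE.
by rewrite -[i]/(val (Sub i iS' : {i in ~: S})) merge_notin ffunE.
Qed.

Lemma prod_merge (f : T -> R) u v :
  \prod_i f (merge_ffun t0 u v i) = (\prod_i f (u i)) * (\prod_i f (v i)).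
Proof.
rewrite (bigID (mem S)) /=; congr (_ * _).
  by rewrite big_sub; apply: eq_bigr => i _; rewrite merge_in.
rewrite (eq_bigl (mem (~: S))) => [|i]; last by rewrite !inE.
by rewrite big_sub; apply: eq_bigr => i _; rewrite merge_notin.
Qed.

Lemma exists_notin_merge (E : pred T) u v :
  [exists i, (i \notin S) && E (merge_ffun t0 u v i)] = [exists i, E (v i)].
Proof.
apply/existsP/existsP => [[i /andP[iS Ei]]|[i Ei]].
  have iS' : i \in ~: S by rewrite inE.
  exists (Sub i iS' : {i in ~: S}).
  by move: Ei; rewrite -[i]/(val (Sub i iS' : {i in ~: S})) merge_notin.
exists (val i); rewrite merge_notin Ei andbT.
by have := valP i; rewrite inE.
Qed.

Lemma forall_in_merge (E : pred T) u v :
  [forall i, (i \in S) ==> E (merge_ffun t0 u v i)] = [forall i, E (u i)].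
Proof.
apply/forallP/forallP => [H i|H i].
  by have /implyP := H (val i); rewrite merge_in; apply; exact: valP.
apply/implyP => iS; rewrite -[i]/(val (Sub i iS : {i in S})) merge_in.
exact: H.
Qed.

End Merge.

(** By independence, the probability that no index satisfies [E] is a product of factors at least
    [1 - e]. *)
Lemma prob_exists_le (I T : finType) (W : T -> R) (E : pred T) (e : R) :
  (forall t, 0 <= W t) -> \sum_t W t = 1 ->
  \sum_t W t * (E t)%:R <= e -> e <= 1 ->
  \sum_(v : {ffun I -> T}) (\prod_i W (v i)) * [exists i, E (v i)]%:R
    <= 1 - (1 - e) ^+ #|I|.
Proof.
move=> W0 W1 We e1.
have compl v : [exists i, E (v i)]%:R
    = 1 - \prod_(i : I) (~~ E (v i))%:R :> R.
  have [/existsP[i Ei]|/existsPn nE] := boolP [exists i, E (v i)].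
    by rewrite (bigD1 i) //= Ei mul0r subr0.
  by rewrite big1 ?subrr // => i _; rewrite nE.
under eq_bigr do rewrite compl mulrBr mulr1 -big_split /=.
rewrite sumrB -(bigA_distr_bigA (fun _ : I => W)) /=.
rewrite -(bigA_distr_bigA (fun (_ : I) t => W t * (~~ E t)%:R)) /=.
rewrite big1 ?W1 // lerD2l lerN2 -prodr_const; apply: ler_prod => i _.
rewrite subr_ge0 e1 /= lerBlDr.
apply: le_trans (lerD (lexx _) We); rewrite -big_split -[leLHS]W1; apply: ler_sum => t _.
by rewrite /= -mulrDr -natrD; case: (E t); rewrite mulr1.
Qed.

End FiniteSums.

(** * The scheme as a finite probability space; reduction of both errors to exponential moments *)

Section Scheme.
Context {R : realType}.
Variables (k m N : nat) (p q U : 'I_k.+1 -> R).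
Hypothesis p01 : forall a, 0 < p a < 1.
Hypothesis q_gt0 : forall a, 0 < q a.
Hypothesis q_sum1 : \sum_a q a = 1.
Implicit Types (nu : biasvec k m) (t : {ffun 'I_m -> bool}) (y : pword m).

Definition bit_prob (a : 'I_k.+1) (b : bool) : R := if b then p a else 1 - p a.

Definition word_prob nu t : R := \prod_j bit_prob (nu j) (t j).

Definition bit_score (a : 'I_k.+1) (o : option bool) (b : bool) : R :=
  if o == Some true then (if b then U a else - U (rev_ord a)) else 0.

Definition word_score nu y t : R := \sum_j bit_score (nu j) (y j) (t j).

Lemma bit_prob_ge0 a b : 0 <= bit_prob a b.
Proof. by have := p01 a; case: b; rewrite /bit_prob; lra. Qed.

Lemma word_prob_ge0 nu t : 0 <= word_prob nu t.
Proof. by apply: prodr_ge0 => j _; exact: bit_prob_ge0. Qed.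

Lemma word_prob_sum1 nu : \sum_t word_prob nu t = 1.
Proof.
rewrite -(bigA_distr_bigA (fun j => bit_prob (nu j))) big1 //= => j _.
by rewrite big_bool /= addrC subrK.
Qed.

Lemma family_prob_sum1 (I : finType) nu :
  \sum_(v : {ffun I -> {ffun 'I_m -> bool}}) \prod_i word_prob nu (v i) = 1.
Proof.
rewrite -(bigA_distr_bigA (fun _ : I => word_prob nu)) big1 //= => i _.
exact: word_prob_sum1.
Qed.

Lemma bias_prob_sum1 : \sum_(nu : biasvec k m) \prod_(j < m) q (nu j) = 1.
Proof. by rewrite -(bigA_distr_bigA (fun _ => q)) big1. Qed.

Lemma bias_prob_ge0 nu : 0 <= \prod_(j < m) q (nu j).
Proof. by apply: prodr_ge0 => j _; rewrite ltW. Qed.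

(** Markov's inequality for the exponential of the score. Positions whose answer is not 1 contribute
    a factor 1, which [1 <= K] covers. *)
Lemma word_tail_bound (alpha K Z : R) nu y : 0 < alpha -> 1 <= K ->
  (forall a, p a * expR (alpha * U a)
             + (1 - p a) * expR (- (alpha * U (rev_ord a))) <= K) ->
  \sum_t word_prob nu t * (Z <= word_score nu y t)%R%:R
    <= expR (- (alpha * Z)) * K ^+ m.
Proof.
move=> alpha0 K1 UK.
have markov t : word_prob nu t * (Z <= word_score nu y t)%R%:R
    <= expR (- (alpha * Z)) * \prod_j (bit_prob (nu j) (t j)
         * expR (alpha * bit_score (nu j) (y j) (t j))).
  rewrite big_split /= -expR_sum -mulr_sumr mulrCA -expRD.
  apply: ler_wpM2l; first exact: word_prob_ge0.
  case: (boolP (Z <= _)) => [Zs|_]; last exact: expR_ge0.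
  rewrite -[leLHS]expR0 ler_expR addrC subr_ge0.
  by rewrite ler_pM2l.
apply: le_trans (ler_sum _ (fun t _ => markov t)) _.
rewrite -mulr_sumr ler_wpM2l ?expR_ge0 //.
rewrite -(bigA_distr_bigA (fun j b => bit_prob (nu j) b
  * expR (alpha * bit_score (nu j) (y j) b))) /=.
rewrite -[X in _ <= K ^+ X]card_ord -prodr_const; apply: ler_prod => j _.
rewrite sumr_ge0 => [|b _]; last by rewrite mulr_ge0 ?bit_prob_ge0 ?expR_ge0.
rewrite big_bool /bit_prob /bit_score; case: (_ == _) => /=.
  by rewrite mulrN; exact: UK.
by rewrite mulr0 expR0 !mulr1 addrC subrK.
Qed.

Variables (S : {set 'I_N}) (rho : codes N m -> pword m -> R).
Hypothesis rhoS : pirate_strategy S rho.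

Local Notation word := {ffun 'I_m -> bool}.
Local Notation pirates := {ffun {i in S} -> word}.
Local Notation innocents := {ffun {i in ~: S} -> word}.

Let t0 : word := [ffun=> false].

(** The innocents' rows are filled with the zero word; by [rho_merge] any filling gives the same
    distribution. *)
Definition pirate_rho (u : pirates) : pword m -> R :=
  rho (merge_ffun t0 u [ffun=> t0]).

Lemma rho_merge (u : pirates) (v : innocents) :
  rho (merge_ffun t0 u v) = pirate_rho u.
Proof.
case: rhoS => _ _ rho_dep _; apply: rho_dep => i iS.
by rewrite -[i]/(val (Sub i iS : {i in S})) !merge_in.
Qed.

(** Since the answer ignores the innocents, their codewords can be summed innermost, with biases,
    pirates' codewords and answer fixed. *)
Lemma scheme_prob_split (E : biasvec k m -> codes N m -> pword m -> bool) :
  scheme_prob p q rho E =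
  \sum_(nu : biasvec k m) \sum_(u : pirates) \sum_(y : pword m)
    (\prod_(j < m) q (nu j)) * (\prod_i word_prob nu (u i)) * pirate_rho u y
    * \sum_(v : innocents) (\prod_i word_prob nu (v i))
                           * (E nu (merge_ffun t0 u v) y)%:R.
Proof.
apply: eq_bigr => nu _; rewrite (sum_merge _ _ S t0); apply: eq_bigr => u _.
rewrite exchange_big; apply: eq_bigr => y _ /=; rewrite mulr_sumr.
apply: eq_bigr => v _; rewrite rho_merge.
have := prod_merge _ _ _ t0 (word_prob nu) u v; rewrite /word_prob /bit_prob => ->.
by rewrite -!mulrA; do 2!congr (_ * _); rewrite mulrCA.
Qed.

Lemma pirate_weight_ge0 nu (u : pirates) y :
  0 <= (\prod_(j < m) q (nu j)) * (\prod_i word_prob nu (u i)) * pirate_rho u y.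
Proof.
case: rhoS => rho0 _ _ _.
rewrite !mulr_ge0 ?bias_prob_ge0 //; last exact: rho0.
by apply: prodr_ge0 => i _; exact: word_prob_ge0.
Qed.

Lemma pirate_weight_sum1 :
  \sum_(nu : biasvec k m) \sum_(u : pirates) \sum_(y : pword m)
    (\prod_(j < m) q (nu j)) * (\prod_i word_prob nu (u i)) * pirate_rho u y = 1.
Proof.
case: rhoS => _ rho1 _ _.
under eq_bigr => nu _.
  under eq_bigr => u _ do rewrite -mulr_sumr rho1 mulr1.
  rewrite -mulr_sumr family_prob_sum1 mulr1; over.
exact: bias_prob_sum1.
Qed.

(** Once biases and answer are fixed, [prob_exists_le] applies to the innocents; the result is
    averaged against weights of total 1. *)
Lemma false_pos_bound (e Z : R) : e <= 1 ->
  (forall nu y, \sum_t word_prob nu t * (Z <= word_score nu y t)%R%:R <= e) ->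
  scheme_prob p q rho (false_pos U Z S) <= 1 - (1 - e) ^+ (N - #|S|).
Proof.
move=> e1 tail; rewrite scheme_prob_split -[leRHS]mul1r -[X in _ <= X * _]pirate_weight_sum1.
rewrite mulr_suml; apply: ler_sum => nu _.
rewrite mulr_suml; apply: ler_sum => u _.
rewrite mulr_suml; apply: ler_sum => y _.
apply: ler_wpM2l; first exact: pirate_weight_ge0.
have -> : (N - #|S|)%N = #|{: {i in ~: S}}|.
  have := cardsC S; rewrite card_ord => {1}<-; rewrite addKn card_sig.
  by apply: eq_card => i; rewrite !inE.
under eq_bigr => v _.
  rewrite /false_pos (exists_notin_merge _ _ _ _
    (fun t => Z <= word_score nu y t)); over.
apply: (prob_exists_le _ _ (word_prob nu) (fun t => Z <= word_score nu y t)) => //.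
  exact: word_prob_ge0.
exact: word_prob_sum1.
Qed.

(* The innocent codewords must be summed out before the answer [o] is maximised
   over, since the maximum does not commute with that sum. *)
Lemma false_neg_bound (alpha Z : R) (B : nat -> R) : 0 < alpha ->
  (forall (b : {ffun {i in S} -> bool}) (o : option bool),
     (forall c, (forall i, b i = c) -> o = Some c) ->
     \sum_a q a * \prod_i (bit_prob a (b i) * expR (- (alpha * bit_score a o (b i))))
       <= B (\sum_i b i)%N) ->
  scheme_prob p q rho (false_neg U Z S)
    <= expR (alpha * (#|S|%:R * Z))
       * (\sum_(x < #|S|.+1) 'C(#|S|, x)%:R * B x) ^+ m.
Proof.
move=> alpha0 GB; rewrite scheme_prob_split; case: rhoS => rho0 rho1 _ marking.
have cardS : #|{: {i in S}}| = #|S| by rewrite card_sig.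
pose G (b : {ffun {i in S} -> bool}) o :=
  \sum_a q a * \prod_i (bit_prob a (b i) * expR (- (alpha * bit_score a o (b i)))).
pose col (u : pirates) j : {ffun {i in S} -> bool} := [ffun i => u i j].
(* If every pirate's score is below [Z], their sum is at most [#|S|%:R * Z], so the exponential
   dominates the indicator. *)
have markov nu (u : pirates) y :
   (\prod_(j < m) q (nu j)) * (\prod_i word_prob nu (u i)) * pirate_rho u y
    * (\sum_(v : innocents) (\prod_i word_prob nu (v i))
                           * (false_neg U Z S nu (merge_ffun t0 u v) y)%:R)
   <= expR (alpha * (#|S|%:R * Z)) * (pirate_rho u y
      * \prod_j (q (nu j) * \prod_i (bit_prob (nu j) (col u j i)
                  * expR (- (alpha * bit_score (nu j) (y j) (col u j i)))))).
  have fnE (v : innocents) : false_neg U Z S nu (merge_ffun t0 u v) y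
      = [forall i, word_score nu y (u i) < Z].
    exact: (forall_in_merge _ _ _ _ (fun t => word_score nu y t < Z)).
  (* The event does not involve the innocents, whose probabilities sum to 1. *)
  under [X in _ * X <= _]eq_bigr do rewrite fnE.
  rewrite -mulr_suml family_prob_sum1 mul1r.
  have -> : \prod_j (q (nu j) * \prod_i (bit_prob (nu j) (col u j i)
                  * expR (- (alpha * bit_score (nu j) (y j) (col u j i)))))
     = (\prod_(j < m) q (nu j)) * (\prod_i word_prob nu (u i))
       * expR (- (alpha * \sum_i word_score nu y (u i))).
    rewrite big_split -mulrA; congr (_ * _) => /=.
    rewrite exchange_big /= mulr_sumr -sumrN expR_sum -big_split /=.
    apply: eq_bigr => i _; rewrite /word_score mulr_sumr -sumrN expR_sum -big_split /=.
    by apply: eq_bigr => j _; rewrite ffunE.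
  rewrite mulrCA [expR _ * (_ * _)]mulrCA mulrA [pirate_rho u y * _]mulrC.
  apply: ler_wpM2l; first exact: pirate_weight_ge0.
  rewrite -expRD; case: (boolP [forall i, _]) => [/forallP low|_]; last exact: expR_ge0.
  rewrite -[leLHS]expR0 ler_expR subr_ge0 ler_pM2l //.
  rewrite -cardS -sum1_card natr_sum mulr_suml; apply: ler_sum => i _.
  by rewrite mul1r ltW.
apply: le_trans (ler_sum _ (fun nu _ => ler_sum _ (fun u _ =>
  ler_sum _ (fun y _ => markov nu u y)))) _.
(* With pirates' codewords and answer fixed, the sum over the secret biases goes inside and factors
   over the positions. *)
rewrite exchange_big /=; under eq_bigr => u _.
  rewrite exchange_big /=; under eq_bigr => y _.
    rewrite -!mulr_sumr.
    rewrite -(bigA_distr_bigA (fun j a => q a * \prod_i (bit_prob a (col u j i)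
        * expR (- (alpha * bit_score a (y j) (col u j i)))))) /=; over.
  rewrite -mulr_sumr; over.
rewrite -mulr_sumr; apply: ler_wpM2l; first exact: expR_ge0.
(* The power is expanded back into a sum over the pirates' code matrices, so that the comparison can
   be made matrix by matrix. *)
rewrite -cardS -sum_count -[X in _ ^+ X]card_ord -sum_prod_columns.
apply: ler_sum => u _.
rewrite -[leRHS]mul1r -[X in _ <= X * _](rho1 (merge_ffun t0 u [ffun=> t0])) mulr_suml.
apply: ler_sum => y _; rewrite -/(pirate_rho u y).
(* The Marking Assumption constrains only answers of positive probability; the others contribute
   0. *)
have [->|rho_neq0] := eqVneq (pirate_rho u y) 0; first by rewrite !mul0r.
apply: ler_wpM2l; first exact: rho0.
apply: ler_prod => j _; apply/andP; split.
  apply: sumr_ge0 => a _; apply: mulr_ge0; first exact: ltW.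
  by apply: prodr_ge0 => i _; rewrite mulr_ge0 ?bit_prob_ge0 ?expR_ge0.
apply: GB => c colc.
apply: (marking (merge_ffun t0 u [ffun=> t0])) => [|i iS].
  by rewrite lt_neqAle eq_sym rho_neq0; exact: rho0.
rewrite -[i]/(val (Sub i iS : {i in S})) merge_in.
by rewrite -(colc (Sub i iS)) ffunE.
Qed.

Lemma scheme_prob_or (E F : biasvec k m -> codes N m -> pword m -> bool) :
  scheme_prob p q rho (fun nu w y => E nu w y || F nu w y)
    <= scheme_prob p q rho E + scheme_prob p q rho F.
Proof.
rewrite /scheme_prob -big_split; apply: ler_sum => nu _.
rewrite -big_split; apply: ler_sum => w _.
rewrite -big_split; apply: ler_sum => y _ /=.
rewrite -mulrDr -natrD; apply: ler_wpM2l; last by rewrite ler_nat; case: E; case: F.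
case: rhoS => rho0 _ _ _; rewrite !mulr_ge0 ?bias_prob_ge0 //.
apply: prodr_ge0 => i _; exact: (word_prob_ge0 nu (w i)).
Qed.

End Scheme.

(** * Binomial sums and the second moment of a column score *)

Section Binomial.
Context {R : realType}.

(** Pascal's rule, read as conditioning on the outcome of one trial. *)
Lemma binomial_sum_recl (p : R) (l : nat) (F : nat -> R) :
  \sum_(x < l.+2) 'C(l.+1, x)%:R * (p ^+ x * (1 - p) ^+ (l.+1 - x) * F x)
  = p * (\sum_(x < l.+1) 'C(l, x)%:R * (p ^+ x * (1 - p) ^+ (l - x) * F x.+1))
    + (1 - p) * (\sum_(x < l.+1) 'C(l, x)%:R * (p ^+ x * (1 - p) ^+ (l - x) * F x)).
Proof.
rewrite big_ord_recl /=.
under eq_bigr => x _ do rewrite /bump /= add1n binS natrD subSS mulrDl.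
rewrite big_split /= addrA addrC !mulr_sumr; congr (_ + _).
  by apply: eq_bigr => x _; rewrite exprS; ring.
rewrite big_ord_recr /= (bin_small (ltnSn l)) mul0r addr0 [RHS]big_ord_recl /=.
rewrite !bin0 !subn0 !expr0; congr (_ + _); first by rewrite exprS; ring.
apply: eq_bigr => x _; rewrite /bump /= add1n.
by rewrite -[(l - x)%N]subnSK // [(1 - p) ^+ _.+1]exprS; ring.
Qed.

Lemma binomial_sum1 (p : R) (l : nat) :
  \sum_(x < l.+1) 'C(l, x)%:R * (p ^+ x * (1 - p) ^+ (l - x)) = 1.
Proof.
under eq_bigr => x _ do rewrite -[_ * _ ^+ _]mulr1.
elim: l => [|l IH]; first by rewrite big_ord1 bin0 !expr0 !mulr1.
by rewrite (binomial_sum_recl p l (fun=> 1)) IH; ring.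
Qed.

(* The shift [a] makes the induction on the number of trials go through. *)
Lemma binomial_score_sqr (p a : R) (l : nat) : 0 < p < 1 ->
  \sum_(x < l.+1) 'C(l, x)%:R * (p ^+ x * (1 - p) ^+ (l - x)
    * (a + (x%:R * sigma p - (l - x)%:R * sigma (1 - p))) ^+ 2) = a ^+ 2 + l%:R.
Proof.
move=> p01; have p01' : 0 < 1 - p < 1 by lra.
have s1 := mul_sigmaC p p01; have s2 := mul_sigma_sqr p p01.
have := mul_sigma_sqr _ p01'; rewrite subKr => s3.
elim: l a => [|l IH] a; first
  by rewrite big_ord1 bin0 !expr0 /= !mul0r subrr addr0 !mul1r addr0.
rewrite (binomial_sum_recl p l
  (fun x => (a + (x%:R * sigma p - (l.+1 - x)%:R * sigma (1 - p))) ^+ 2)).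
(* The trial is absorbed into the shift: a one moves [a] to [a + sigma p], a zero to
   [a - sigma (1 - p)]. *)
have up : \sum_(x < l.+1) 'C(l, x)%:R * (p ^+ x * (1 - p) ^+ (l - x)
    * (a + (x.+1%:R * sigma p - (l.+1 - x.+1)%:R * sigma (1 - p))) ^+ 2)
    = (a + sigma p) ^+ 2 + l%:R.
  by rewrite -IH; apply: eq_bigr => x _; rewrite subSS -natr1; ring.
have down : \sum_(x < l.+1) 'C(l, x)%:R * (p ^+ x * (1 - p) ^+ (l - x)
    * (a + (x%:R * sigma p - (l.+1 - x)%:R * sigma (1 - p))) ^+ 2)
    = (a - sigma (1 - p)) ^+ 2 + l%:R.
  by rewrite -IH; apply: eq_bigr => x _; rewrite subSn ?leq_ord // -natr1; ring.
rewrite up down -natr1.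
(* The linear term vanishes by [mul_sigmaC], and the squares add up to [(1 - p) + p]. *)
transitivity (a ^+ 2 + l%:R + 2 * a * (p * sigma p - (1 - p) * sigma (1 - p))
  + (p * sigma p ^+ 2 + (1 - p) * sigma (1 - p) ^+ 2)); first by ring.
by rewrite s1 s2 s3; ring.
Qed.

End Binomial.

(** * Moment bounds at one position, for an innocent bit and for a column of pirates' bits *)

Section Bounds.
Context {R : realType}.
Variables (k : nat) (p q U : 'I_k.+1 -> R) (delta : R).
Hypothesis bias : finite_bias_dist p q.
Hypothesis U_sigma : forall i, `|U i - sigma (p i)| <= delta.

Let p01 a : 0 < p a < 1. Proof. by case: bias. Qed.
Let q_gt0 a : 0 < q a. Proof. by case: bias. Qed.
Let q_sum1 : \sum_a q a = 1. Proof. by case: bias. Qed.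
Let prev a : p (rev_ord a) = 1 - p a. Proof. by case: bias => _ _ _ _ /(_ a)[]. Qed.
Let qrev a : q (rev_ord a) = q a. Proof. by case: bias => _ _ _ _ /(_ a)[]. Qed.

Lemma bias_sigma_le a : sigma (p a) <= sigma (p ord0).
Proof.
case: (posnP a) => [a0|a0]; first by have -> : a = ord0 by exact: val_inj.
have p0a : p ord0 < p a by case: bias => _ mono _ _ _; exact: mono.
by have := p01 a; have := p01 ord0 => ? ?; apply: sigma_anti; lra.
Qed.

Lemma bias_sigma_rev_le a : sigma (1 - p a) <= sigma (p ord0).
Proof. by rewrite -prev bias_sigma_le. Qed.

Lemma U_bounds a : sigma (p a) - delta <= U a <= sigma (p a) + delta.
Proof. by have := U_sigma a; rewrite ler_norml; lra. Qed.

Lemma U_rev_bounds a :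
  sigma (1 - p a) - delta <= U (rev_ord a) <= sigma (1 - p a) + delta.
Proof. by rewrite -prev; exact: U_bounds. Qed.

(** After the quadratic bound only the mean 0 and the second moment 1 of the exact score matter;
    [expR (alpha * delta)] pays for using [U] instead of [sigma]. *)
Lemma bit_mgf_bound (alpha x : R) a : 0 < alpha -> 0 < x ->
  alpha * sigma (p ord0) <= x ->
  p a * expR (alpha * U a) + (1 - p a) * expR (- (alpha * U (rev_ord a)))
    <= expR (alpha * delta) * (1 + rfun x * alpha ^+ 2).
Proof.
move=> alpha0 x0 ax; have p01a := p01 a; have p01' : 0 < 1 - p a < 1 by lra.
have s1 := mul_sigmaC _ p01a; have s2 := mul_sigma_sqr _ p01a.
have := mul_sigma_sqr _ p01'; rewrite subKr => s3.
have [U1 U2] := (U_bounds a, U_rev_bounds a).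
have up : expR (alpha * U a) <= expR (alpha * delta)
    * (1 + alpha * sigma (p a) + rfun x * (alpha * sigma (p a)) ^+ 2).
  apply: (@le_trans _ _ (expR (alpha * delta) * expR (alpha * sigma (p a)))).
    by rewrite -expRD ler_expR -mulrDr ler_pM2l //; lra.
  rewrite ler_pM2l ?expR_gt0 //; apply: expR_le_quadratic => //.
  rewrite ger0_norm ?mulr_ge0 ?sigma_ge0 ?(ltW alpha0) //.
  by apply: le_trans ax; rewrite ler_pM2l // bias_sigma_le.
have down : expR (- (alpha * U (rev_ord a))) <= expR (alpha * delta)
    * (1 - alpha * sigma (1 - p a) + rfun x * (alpha * sigma (1 - p a)) ^+ 2).
  apply: (@le_trans _ _ (expR (alpha * delta) * expR (- (alpha * sigma (1 - p a))))).
    by rewrite -expRD ler_expR -mulrBr -mulrN ler_pM2l //; lra.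
  rewrite ler_pM2l ?expR_gt0 //.
  rewrite -[(alpha * sigma (1 - p a)) ^+ 2]sqrrN; apply: expR_le_quadratic => //.
  rewrite normrN ger0_norm ?mulr_ge0 ?sigma_ge0 ?(ltW alpha0) //.
  by apply: le_trans ax; rewrite ler_pM2l // bias_sigma_rev_le.
apply: (@le_trans _ _
   (p a * (expR (alpha * delta)
      * (1 + alpha * sigma (p a) + rfun x * (alpha * sigma (p a)) ^+ 2))
    + (1 - p a) * (expR (alpha * delta)
      * (1 - alpha * sigma (1 - p a) + rfun x * (alpha * sigma (1 - p a)) ^+ 2)))).
  by apply: lerD; apply: ler_wpM2l => //; lra.
rewrite le_eqVlt; apply/orP; left; apply/eqP.
transitivity (expR (alpha * delta)
   * (1 + alpha * (p a * sigma (p a) - (1 - p a) * sigma (1 - p a))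
      + rfun x * alpha ^+ 2
        * (p a * sigma (p a) ^+ 2 + (1 - p a) * sigma (1 - p a) ^+ 2))).
  by ring.
by rewrite s1 s2 s3; ring.
Qed.

Lemma fpoly_rev l x (t : R) : (x <= l)%N ->
  fpoly l (l - x) (1 - t) = - fpoly l x t.
Proof. by move=> xl; rewrite /fpoly subKn // subKr; ring. Qed.

Lemma Ebias_fpoly_rev l x : (x <= l)%N ->
  Ebias p q (fpoly l (l - x)) = - Ebias p q (fpoly l x).
Proof.
move=> xl; rewrite /Ebias (reindex_inj rev_ord_inj) -sumrN.
by apply: eq_bigr => a _; rewrite prev qrev fpoly_rev // mulrN.
Qed.

Section Column.
Variables (l : nat) (alpha r : R).

(** This is the probability of one particular column with [x] ones. Here and in [count_sqr] the
    number of such columns is left out; it enters as a binomial coefficient in the sums. *)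
Definition count_prob (x : nat) : R :=
  \sum_a q a * (p a ^+ x * (1 - p a) ^+ (l - x)).

Definition count_sqr (x : nat) : R :=
  \sum_a q a * (p a ^+ x * (1 - p a) ^+ (l - x)
    * (x%:R * sigma (p a) - (l - x)%:R * sigma (1 - p a)) ^+ 2).

(* Worst first-order term over the answers which the Marking Assumption allows
   on a column with [x] ones. *)
Definition count_loss (x : nat) : R :=
  if x == 0 then 0 else if x == l then - Ebias p q (fpoly l x)
  else Num.max 0 (- Ebias p q (fpoly l x)).

(** Serves as [B] in [false_neg_bound]. The exponential factor absorbs an error [delta] for each of
    the [l] pirates. *)
Definition count_bound (x : nat) : R :=
  expR (alpha * (l%:R * delta))
  * (count_prob x + alpha * count_loss x + r * alpha ^+ 2 * count_sqr x).

Lemma count_prob_sum : \sum_(x < l.+1) 'C(l, x)%:R * count_prob x = 1.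
Proof.
rewrite /count_prob; under eq_bigr do rewrite mulr_sumr.
rewrite exchange_big /= -[RHS]q_sum1; apply: eq_bigr => a _.
under eq_bigr do rewrite mulrCA.
by rewrite -mulr_sumr binomial_sum1 mulr1.
Qed.

Lemma count_sqr_sum : \sum_(x < l.+1) 'C(l, x)%:R * count_sqr x = l%:R.
Proof.
rewrite /count_sqr; under eq_bigr do rewrite mulr_sumr.
rewrite exchange_big /= -[RHS]mul1r -[X in _ = X * _]q_sum1 mulr_suml.
apply: eq_bigr => a _; under eq_bigr do rewrite mulrCA.
rewrite -mulr_sumr; congr (_ * _).
have := binomial_score_sqr (p a) 0 l (p01 a); rewrite expr2 mul0r add0r => <-.
by apply: eq_bigr => x _; rewrite add0r.
Qed.

(** The reflection of [x] to [l - x] turns each maximum into an [Rlx]. The all-ones column, where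
    the answer 1 is forced, supplies the expectation of [fpoly l 0]. *)
Lemma count_loss_sum : (0 < l)%N ->
  \sum_(x < l.+1) 'C(l, x)%:R * count_loss x = - calR p q l.
Proof.
move=> l0; rewrite -(big_mkord xpredT (fun x => 'C(l, x)%:R * count_loss x)).
rewrite big_nat_recr //= big_ltn //= {1}/count_loss eqxx mulr0 add0r.
rewrite /count_loss (gtn_eqF l0) eqxx binn mul1r /calR opprB.
congr (_ + _); last first.
  have := Ebias_fpoly_rev l 0 (leq0n l); rewrite subn0 => ->.
  rewrite opprK /Ebias -sumrN.
  by apply: eq_bigr => a _; rewrite mulrN opprK.
rewrite big_nat_rev /= !big_nat; apply: eq_bigr => x /andP[x1 xl].
have -> : (1 + l - x.+1)%N = (l - x)%N by rewrite add1n subSS.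
rewrite (bin_sub (ltnW xl)).
have -> : (l - x == 0)%N = false by rewrite subn_eq0 leqNgt xl.
have -> : (l - x == l)%N = false.
  by apply/negbTE; rewrite neq_ltn ltn_subrL x1 l0.
by rewrite /Rlx (Ebias_fpoly_rev _ _ (ltnW xl)) opprK.
Qed.

Lemma count_bound_sum : (0 < l)%N ->
  \sum_(x < l.+1) 'C(l, x)%:R * count_bound x
  = expR (alpha * (l%:R * delta)) * (1 - alpha * calR p q l + r * alpha ^+ 2 * l%:R).
Proof.
move=> l0; rewrite -mulrN -count_loss_sum // -[X in _ * (X + _ + _)]count_prob_sum.
rewrite -[X in _ = _ * (_ + _ * X)]count_sqr_sum.
rewrite !mulr_sumr -!big_split mulr_sumr /=.
by apply: eq_bigr => x _; rewrite /count_bound; ring.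
Qed.

End Column.

Lemma count0P {I : finType} (b : {ffun I -> bool}) :
  (\sum_i b i)%N = 0%N -> forall i, b i = false.
Proof.
move=> /eqP; rewrite sum_nat_eq0 => /forallP b0 i.
by apply/negbTE; rewrite -eqb0; exact: b0.
Qed.

Lemma count_fullP {I : finType} (b : {ffun I -> bool}) :
  (\sum_i b i)%N = #|I| -> forall i, b i = true.
Proof.
move=> bI i; apply/negP => /negP bi.
have : (\sum_i b i < #|I|)%N.
  rewrite -sum1_card (bigD1 i) //= [X in (_ < X)%N](bigD1 i) //= (negbTE bi).
  by rewrite add0n add1n ltnS; apply: leq_sum => j _; case: (b j).
by rewrite bI ltnn.
Qed.

(** An answer other than 1 gives all pirates score 0, so the moment is exactly [count_prob]; for the
    answer 1 the exponential is expanded quadratically. [count_loss] dominates the first-order term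
    in both cases. *)
Lemma column_bound (I : finType) (alpha x : R)
    (b : {ffun I -> bool}) (o : option bool) :
  (0 < #|I|)%N -> 0 <= delta -> 0 < alpha -> 0 < x ->
  alpha * #|I|%:R * sigma (p ord0) <= x ->
  (forall c, (forall i, b i = c) -> o = Some c) ->
  \sum_a q a * \prod_i (bit_prob k p a (b i)
                        * expR (- (alpha * bit_score k U a o (b i))))
    <= count_bound #|I| alpha (rfun x) (\sum_i b i)%N.
Proof.
move=> I0 delta0 alpha0 x0 ax allowed.
have r0 := rfun_gt0 _ x0.
set l := #|I| in I0 ax *; set n := (\sum_i b i)%N.
have nl : (n <= l)%N by exact: count_le.
have weight_ge0 a : 0 <= q a * (p a ^+ n * (1 - p a) ^+ (l - n)).
  have := p01 a => ?; rewrite mulr_ge0 ?ltW // mulr_gt0 // exprn_gt0 //; lra.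
have e1 : 1 <= expR (alpha * (l%:R * delta)).
  by rewrite -[leLHS]expR0 ler_expR !mulr_ge0 ?ler0n ?(ltW alpha0).
have [o1|o1] := boolP (o == Some true); last first.
  have -> : \sum_a q a * \prod_i (bit_prob k p a (b i)
      * expR (- (alpha * bit_score k U a o (b i)))) = count_prob l n.
    apply: eq_bigr => a _; congr (_ * _); rewrite -prod_if_count.
    apply: eq_bigr => i _; rewrite /bit_score (negbTE o1) mulr0 oppr0 expR0.
    by rewrite mulr1.
  (* The loss could be negative only on the all-ones column, which forces the answer 1. *)
  have loss0 : 0 <= count_loss l n.
    rewrite /count_loss; case: eqP => // _; case: eqP => [nl'|_].
      by have /allowed oS := count_fullP b nl'; rewrite oS eqxx in o1.
    by rewrite le_max lexx.
  have prob0 : 0 <= count_prob l n by apply: sumr_ge0.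
  have sqr0 : 0 <= count_sqr l n.
    by apply: sumr_ge0 => a _; rewrite mulrA mulr_ge0 ?sqr_ge0.
  rewrite /count_bound -[leLHS]mul1r; apply: ler_pM => //.
  rewrite -addrA lerDl addr_ge0 // mulr_ge0 ?(ltW alpha0) //.
  by rewrite mulr_ge0 ?sqr_ge0 ?ltW.
have n0 : n != 0%N.
  by apply/eqP => /count0P/allowed oS; rewrite oS in o1.
(* The exact total score of the pirates in this column when the answer is 1. *)
pose s a := n%:R * sigma (p a) - (l - n)%:R * sigma (1 - p a).
apply: (@le_trans _ _ (expR (alpha * (l%:R * delta))
  * (count_prob l n - alpha * Ebias p q (fpoly l n)
     + rfun x * alpha ^+ 2 * count_sqr l n))); last first.
  rewrite ler_pM2l ?expR_gt0 // lerD2r lerD2l -mulrN ler_pM2l //.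
  by rewrite /count_loss (negbTE n0); case: eqP => // _; rewrite le_max lexx orbT.
rewrite /count_prob /Ebias /count_sqr !mulr_sumr -sumrN -!big_split mulr_sumr /=.
apply: ler_sum => a _.
have -> : \prod_i (bit_prob k p a (b i) * expR (- (alpha * bit_score k U a o (b i))))
   = p a ^+ n * (1 - p a) ^+ (l - n)
     * expR (- (alpha * (n%:R * U a - (l - n)%:R * U (rev_ord a)))).
  transitivity (\prod_i (if b i then p a * expR (- (alpha * U a))
                         else (1 - p a) * expR (alpha * U (rev_ord a)))).
    apply: eq_bigr => i _; rewrite /bit_score o1 /bit_prob.
    by case: (b i); rewrite // mulrN opprK.
  rewrite prod_if_count -/l -/n !exprMn -!expRM_natl mulrACA -expRD.
  by congr (_ * expR _); ring.
rewrite mulrA.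
have -> : expR (alpha * (l%:R * delta)) *
   (q a * (p a ^+ n * (1 - p a) ^+ (l - n)) - alpha * (q a * fpoly l n (p a))
    + rfun x * alpha ^+ 2 * (q a * (p a ^+ n * (1 - p a) ^+ (l - n) * s a ^+ 2)))
  = q a * (p a ^+ n * (1 - p a) ^+ (l - n))
    * (expR (alpha * (l%:R * delta))
       * (1 + - (alpha * s a) + rfun x * (- (alpha * s a)) ^+ 2)).
  by rewrite /fpoly /s; ring.
apply: ler_wpM2l => //.
(* Passing from [U] to [sigma] costs at most [delta] per pirate. *)
apply: (@le_trans _ _ (expR (alpha * (l%:R * delta)) * expR (- (alpha * s a)))).
  rewrite -expRD ler_expR -mulrN -mulrBr ler_pM2l //.
  have := U_bounds a; have := U_rev_bounds a.
  have -> : l%:R = n%:R + (l - n)%:R :> R by rewrite -natrD subnKC.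
  have : 0 <= n%:R :> R by []. have : 0 <= (l - n)%:R :> R by [].
  rewrite /s; nra.
rewrite ler_pM2l ?expR_gt0 //; apply: expR_le_quadratic => //.
rewrite normrN normrM gtr0_norm //; apply: le_trans ax.
rewrite -mulrA ler_pM2l //.
have := sigma_ge0 (p a); have := sigma_ge0 (1 - p a).
have := bias_sigma_le a; have := bias_sigma_rev_le a.
have -> : l%:R = n%:R + (l - n)%:R :> R by rewrite -natrD subnKC.
have : 0 <= n%:R :> R by []. have : 0 <= (l - n)%:R :> R by [].
by rewrite ler_norml /s => *; apply/andP; split; nra.
Qed.

(** Each column bound dominates a nonnegative moment. This sign is needed to compare [m]-th powers
    in [chernoff_lt]. *)
Lemma count_bound_sum_ge0 (I : finType) (alpha x : R) :
  (0 < #|I|)%N -> 0 <= delta -> 0 < alpha -> 0 < x ->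
  alpha * #|I|%:R * sigma (p ord0) <= x ->
  0 <= \sum_(n < #|I|.+1) 'C(#|I|, n)%:R * count_bound #|I| alpha (rfun x) n.
Proof.
move=> I0 delta0 alpha0 x0 ax; rewrite -sum_count; apply: sumr_ge0 => b _.
(* The answer chosen is 1 exactly on the all-ones column; it is allowed because [I] is nonempty. *)
apply: le_trans (column_bound _ _ _ b (Some [forall i, b i]) I0 delta0 alpha0 x0 ax _).
  apply: sumr_ge0 => a _; apply: mulr_ge0; first exact: ltW.
  by apply: prodr_ge0 => i _; rewrite mulr_ge0 ?expR_ge0 ?bit_prob_ge0.
case=> bc; congr Some; first exact/forallP.
have /card_gt0P[i _] := I0.
by apply/negP => /forallP/(_ i); rewrite bc.
Qed.

End Bounds.

(** * Numerical estimates, choice of the exponents, and the final error bounds *)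

Lemma bernoulli_ineq {R : realType} (e : R) n : 0 <= e <= 1 ->
  1 - (1 - e) ^+ n <= n%:R * e.
Proof.
move=> e01; elim: n => [|n IH]; first by rewrite expr0 subrr mul0r.
have : (1 - e) ^+ n <= 1 by apply: exprn_ile1; lra.
rewrite exprS -natr1; move: IH; set z := (1 - e) ^+ n; nra.
Qed.

(** Strictness comes from [1 + u < expR u] for nonzero [u], and survives the power because [m] is
    positive. *)
Lemma chernoff_lt {R : realType} (m : nat) (u v z d eps : R) : (0 < m)%N ->
  0 < eps -> u != 0 -> 0 <= v -> v <= 1 + u ->
  ln eps^-1 <= z - m%:R * (d + u) ->
  expR (- z) * (expR d * v) ^+ m < eps.
Proof.
move=> m0 eps0 u0 v0 vu exponent.
apply: (@lt_le_trans _ _ (expR (- z) * expR (m%:R * (d + u)))).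
  rewrite ltr_pM2l ?expR_gt0 // expRM_natl ltrXn2r -?lt0n //.
    by rewrite mulr_ge0 ?expR_ge0.
  by rewrite expRD ltr_pM2l ?expR_gt0 // (le_lt_trans vu) // expR_gt1Dx.
rewrite -expRD -[leRHS]lnK ?posrE // ler_expR -[ln eps]opprK -lnV ?posrE //.
by lra.
Qed.

(** For [alpha = x / psi2] this bounds the second-order term [rfun x * alpha ^+ 2] by
    [C * alpha]. *)
Lemma scaled_rfun_le {R : realType} (x C psi1 psi2 : R) : 0 < x -> 0 <= C ->
  0 < psi1 -> psi1 <= psi2 -> x * rfun x <= C * psi1 ->
  rfun x * (x / psi2) <= C.
Proof.
move=> x0 C0 p1 p12 h; have p2 : 0 < psi2 by lra.
rewrite mulrA ler_pdivrMr // mulrC; nra.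
Qed.

Theorem theorem4 (R : realType) (c N k : nat) (p q U : 'I_k.+1 -> R)
  (delta calRR psi1 psi2 eta1 eta2 x1 x2 eps1 eps2 A1 A2 : R) (m : nat) :
  (1 <= c)%N -> (2 <= N)%N ->
  finite_bias_dist p q ->
  0 <= delta ->
  (forall i, `|U i - sigma (p i)| <= delta) ->
  0 < calRR ->
  (forall l : nat, (1 <= l <= c)%N -> calRR <= calR p q l) ->
  0 < psi1 -> 0 < psi2 -> psi1 <= sigma (p ord0) <= psi2 ->
  0 < eta1 -> 0 < eta2 ->
  0 < x1 -> 0 < x2 ->
  x1 * rfun x1 <= eta1 * calRR * psi1 / c%:R ->
  x2 * rfun x2 <= eta2 * calRR * psi1 / c%:R ->
  0 < eps1 < 1 -> 0 < eps2 < 1 ->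
  let D := (1 - eta1 - eta2 / c%:R) * calRR - 2 * delta * c%:R in
  0 < D ->
  A1 >= c%:R / D * (psi2 / x1) * ln (eps1^-1) ->
  A2 >= c%:R / D * (psi2 / x2) * ln (eps2^-1) ->
  (0 < m)%N -> m%:R = A1 + A2 ->
  let Z := ((1 - eta2 / c%:R) * (calRR / c%:R) - delta) * A1
           + (eta1 * calRR / c%:R + delta) * A2 in
  forall (S : {set 'I_N}) (rho : codes N m -> pword m -> R),
    (1 <= #|S| <= c)%N ->
    pirate_strategy S rho ->
    [/\ scheme_prob p q rho (false_pos U Z S) < 1 - (1 - eps1) ^+ (N - 1),
        scheme_prob p q rho (false_neg U Z S) < eps2 &
        scheme_prob p q rho
          (fun nu w y => false_pos U Z S nu w y || false_neg U Z S nu w y)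
          <= (N - 1)%:R * eps1 + eps2].
Proof.
move=> c1 N2 bias delta0 Usig R0 calR_ge psi10 psi20 /andP[psi1s spsi2] eta10 eta20.
move=> x10 x20 hx1 hx2 eps1_01 eps2_01 D D0 hA1 hA2 m0 mA Z S rho /andP[S1 Sc] hrho.
have [p01 _ q_gt0 q_sum1 _] := bias.
have c0 : 0 < c%:R :> R by rewrite ltr0n.
have psi12 : psi1 <= psi2 by lra.
pose e1 := eta1 * calRR / c%:R; pose e2 := eta2 * calRR / c%:R.
have e10 : 0 < e1 by rewrite divr_gt0 ?mulr_gt0.
have e20 : 0 < e2 by rewrite divr_gt0 ?mulr_gt0.
pose Rc := calRR / c%:R.
have Rc0 : 0 < Rc by rewrite divr_gt0.
have Dc : D / c%:R = Rc - e1 - e2 / c%:R - 2 * delta.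
  by rewrite /D /Rc /e1 /e2; field; rewrite gt_eqF.
have Dc0 : 0 < D / c%:R by rewrite divr_gt0.
have ZE : Z = (Rc - e2 / c%:R - delta) * A1 + (e1 + delta) * A2.
  by rewrite /Z /Rc /e1 /e2; field; rewrite gt_eqF.
(* The lower bounds on [A1] and [A2] are put in the form required by the exponent condition of
   [chernoff_lt]. *)
have scale (x A L : R) : 0 < x -> c%:R / D * (psi2 / x) * L <= A ->
    L <= x / psi2 * A * (D / c%:R).
  move=> x0 h; have -> : L = x / psi2 * (c%:R / D * (psi2 / x) * L) * (D / c%:R).
    by field; rewrite !gt_eqF.
  by rewrite ler_pM2r // ler_pM2l // divr_gt0.
have r1 : rfun x1 * (x1 / psi2) <= e1.
  apply: (scaled_rfun_le _ _ psi1) => //; first exact: ltW.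
  by apply: le_trans hx1 _; rewrite /e1 mulrAC.
have r2 : rfun x2 * (x2 / psi2) <= e2.
  apply: (scaled_rfun_le _ _ psi1) => //; first exact: ltW.
  by apply: le_trans hx2 _; rewrite /e2 mulrAC.
have r10 := rfun_gt0 _ x10; have r20 := rfun_gt0 _ x20.
have fp : scheme_prob p q rho (false_pos U Z S) < 1 - (1 - eps1) ^+ (N - 1).
  (* As [sigma (p ord0) <= psi2], this choice keeps every exact score times [alpha] within [x1]. *)
  pose alpha := x1 / psi2.
  have alpha0 : 0 < alpha by rewrite divr_gt0.
  pose K := expR (alpha * delta) * (1 + rfun x1 * alpha ^+ 2).
  pose e := expR (- (alpha * Z)) * K ^+ m.
  have ra0 : 0 < rfun x1 * alpha ^+ 2 by rewrite mulr_gt0 ?exprn_gt0.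
  have e_lt : e < eps1.
    apply: (chernoff_lt _ (rfun x1 * alpha ^+ 2)) => //.
    - by case/andP: eps1_01.
    - by rewrite gt_eqF.
    - by rewrite addr_ge0 // ltW.
    apply: le_trans (scale _ _ _ x10 hA1) _.
    rewrite -/alpha ZE mA Dc; move: r1; rewrite -/alpha => r1.
    rewrite -subr_ge0.
    (* With this [Z], the slack in the exponent is [alpha * m%:R * (e1 - rfun x1 * alpha)],
       nonnegative by [r1]. *)
    have -> : alpha * ((Rc - e2 / c%:R - delta) * A1 + (e1 + delta) * A2)
         - (A1 + A2) * (alpha * delta + rfun x1 * alpha ^+ 2)
       - alpha * A1 * (Rc - e1 - e2 / c%:R - 2 * delta)
       = alpha * ((A1 + A2) * (e1 - rfun x1 * alpha)) by ring.
    by rewrite -mA mulr_ge0 ?(ltW alpha0) // mulr_ge0 ?ler0n // subr_ge0.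
  have e0 : 0 <= e by rewrite mulr_ge0 ?expR_ge0 ?exprn_ge0 // mulr_ge0 ?expR_ge0 //; lra.
  have alpha_sigma : alpha * sigma (p ord0) <= x1.
    by rewrite mulrAC ler_pdivrMr // ler_pM2l.
  apply: le_lt_trans (false_pos_bound _ _ _ _ _ _ p01 q_gt0 q_sum1 _ _ hrho e Z _ _) _.
  - lra.
  - move=> nu y; apply: word_tail_bound => //.
      rewrite -[1]mulr1 ler_pM // ?lerDl ?(ltW ra0) //.
      by rewrite -[leLHS]expR0 ler_expR mulr_ge0 // ltW.
    by move=> a; apply: (bit_mgf_bound _ _ q).
  rewrite ltrD2l ltrN2.
  (* The strict step uses [e < eps1] and [N - 1 > 0]; then the exponent drops to [N - #|S|], as
     there is at least one pirate. *)
  apply: (@lt_le_trans _ _ ((1 - e) ^+ (N - 1))).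
    by rewrite ltrXn2r ?subn_eq0 -?ltnNge //; lra.
  by apply: ler_wiXn2l; [lra | lra | rewrite leq_sub2l].
have fn : scheme_prob p q rho (false_neg U Z S) < eps2.
  set l := #|S| in S1 Sc.
  have l0 : 0 < l%:R :> R by rewrite ltr0n.
  have lc : l%:R <= c%:R :> R by rewrite ler_nat.
  (* The extra division by [l] is needed because the total score of a column can reach
     [l%:R * sigma (p ord0)]. *)
  pose alpha := x2 / psi2 / l%:R.
  have alpha0 : 0 < alpha by rewrite !divr_gt0.
  have alphal : alpha * l%:R = x2 / psi2 by rewrite divfK ?gt_eqF.
  have cardS : #|{: {i in S}}| = l by rewrite card_sig.
  have alpha_sigma : alpha * l%:R * sigma (p ord0) <= x2.
    by rewrite alphal mulrAC ler_pdivrMr // ler_pM2l.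
  apply: le_lt_trans (false_neg_bound _ _ _ _ _ U p01 q_gt0 _ _ hrho alpha Z
    (count_bound k p q delta l alpha (rfun x2)) alpha0 _) _.
    by move=> b o; rewrite -cardS; apply: column_bound; rewrite ?cardS.
  rewrite -/l count_bound_sum //.
  (* Here [calR p q l] is replaced by its lower bound [calRR], which can only increase the moment
     bound. *)
  pose u := - (alpha * calRR) + rfun x2 * alpha ^+ 2 * l%:R.
  have cR : calRR <= calR p q l by apply: calR_ge; rewrite S1.
  have v0 : 0 <= 1 - alpha * calR p q l + rfun x2 * alpha ^+ 2 * l%:R.
    rewrite -(pmulr_rge0 _ (expR_gt0 (alpha * (l%:R * delta)))).
    rewrite -(count_bound_sum k p q delta bias) // -cardS.
    by apply: count_bound_sum_ge0; rewrite ?cardS.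
  (* The left side grows with [l], and at [l = c] it equals [calRR - e2]; then [r2] applies. *)
  have gap : l%:R * (Rc - e2 / c%:R) <= calRR - rfun x2 * (alpha * l%:R).
    have -> : calRR = c%:R * Rc by rewrite mulrC divfK ?gt_eqF.
    have e2c : c%:R * (e2 / c%:R) = e2 by rewrite mulrC divfK ?gt_eqF.
    have : 0 <= (c%:R - l%:R) * (Rc - e2 / c%:R) by rewrite mulr_ge0 //; lra.
    by rewrite alphal mulrBl !mulrBr e2c; lra.
  (* The left side of [gap] is positive because [D / c%:R] is; hence [u] is nonzero, as strictness
     requires. *)
  have u_lt0 : u < 0.
    have -> : u = - (alpha * (calRR - rfun x2 * (alpha * l%:R))) by rewrite /u; ring.
    rewrite oppr_lt0 mulr_gt0 // (lt_le_trans _ gap) // mulr_gt0 //; lra.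
  rewrite -[alpha * (l%:R * Z)]opprK; apply: (chernoff_lt _ u) => //.
  - by case/andP: eps2_01.
  - by rewrite lt_eqF.
  - rewrite /u addrA lerD2r lerD2l lerN2 ler_pM2l //.
  apply: le_trans (scale _ _ _ x20 hA2) _.
  rewrite ZE mA Dc -alphal -subr_ge0.
  (* The slack in the exponent is [alpha * m%:R] times the difference of the two sides of [gap]. *)
  have -> : - (alpha * (l%:R * ((Rc - e2 / c%:R - delta) * A1 + (e1 + delta) * A2)))
       - (A1 + A2) * (alpha * (l%:R * delta) + u)
       - alpha * l%:R * A2 * (Rc - e1 - e2 / c%:R - 2 * delta)
     = alpha * ((A1 + A2) * (calRR - rfun x2 * (alpha * l%:R)
                             - l%:R * (Rc - e2 / c%:R))).
    by rewrite /u; ring.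
  by rewrite -mA mulr_ge0 ?(ltW alpha0) // mulr_ge0 ?ler0n // subr_ge0.
split => //.
apply: le_trans (scheme_prob_or _ _ _ _ _ p01 q_gt0 _ _ hrho _ _) _.
apply: lerD; last exact: ltW.
by apply: le_trans (ltW fp) _; apply: bernoulli_ineq; lra.
Qed.
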